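(* Let $N=[n]$ and $M=[m]$ be non-empty with $m=kn$ for a positive integer $k$, and let agents $i\in N$ have additive valuations with values $v_{ij}\ge 0$. A balanced allocation $A=(A_1,\dots,A_n)$ is fPO if and only if there is a strictly positive weight vector $\alpha\in\mathbb{R}_{>0}^N$ such that $A$ maximizes $\sum_{i\in N}\alpha_i v_i(A_i)$ over all balanced allocations.
   Context: $v_i(X)=\sum_{j\in X}v_{ij}$ for $X\subseteq M$. An allocation is an ordered partition $A=(A_1,\dots,A_n)$ of $M$; it is balanced if $|A_i|=k$ for all $i\in N$. A balanced fractional allocation is a matrix $x\in\mathbb{R}_{\ge 0}^{N\times M}$ with $\sum_{j\in M}x_{ij}=k$ for all $i\in N$ and $\sum_{i\in N}x_{ij}=1$ for all $j\in M$; a balanced allocation is identified with its $0/1$ matrix ($x_{ij}=1$ iff $j\in A_i$). A balanced fractional allocation $x$ Pareto-dominates $x'$ if $\sum_j v_{ij}x_{ij}\ge\sum_j v_{ij}x'_{ij}$ for all $i\in N$, with strict inequality for some $i$. A balanced allocation is fPO (fractionally Pareto optimal) if no balanced fractional allocation Pareto-dominates it. *)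

(* Defs.v *)
From HB Require Import structures.
From mathcomp Require Import all_boot all_order all_algebra.
From mathcomp Require Import reals.

Set Implicit Arguments.
Unset Strict Implicit.
Unset Printing Implicit Defensive.

Import Order.TTheory GRing.Theory Num.Theory.
Local Open Scope ring_scope.

(* Agents are 'I_n, items are 'I_m, and v i j is the value of item j for
   agent i.  The bundle size is the parameter k. *)

Definition value (R : realType) (n m : nat) (v : 'M[R]_(n, m)) (i : 'I_n)
    (X : {set 'I_m}) : R :=
  \sum_(j in X) v i j.

(* Bundles of an ordered partition may be empty here; this is why the finset
   predicate [partition], which is unordered and excludes set0, is not used. *)
Definition allocation (n m : nat) (A : 'I_n -> {set 'I_m}) : Prop :=
  (\bigcup_i A i = [set: 'I_m]) /\
  (forall i i' : 'I_n, i != i' -> [disjoint A i & A i']).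

Definition balanced_allocation (n m k : nat) (A : 'I_n -> {set 'I_m}) : Prop :=
  allocation A /\ forall i, #|A i| = k.

Definition balanced_fractional (R : realType) (n m k : nat)
    (x : 'M[R]_(n, m)) : Prop :=
  [/\ forall i j, 0 <= x i j,
      forall i, \sum_j x i j = k%:R
    & forall j, \sum_i x i j = 1].

Definition alloc_mx (R : realType) (n m : nat) (A : 'I_n -> {set 'I_m}) :
    'M[R]_(n, m) :=
  \matrix_(i, j) (j \in A i)%:R.

Definition pareto_dominates (R : realType) (n m : nat) (v x x' : 'M[R]_(n, m)) :
    Prop :=
  (forall i, \sum_j v i j * x' i j <= \sum_j v i j * x i j) /\
  (exists i, \sum_j v i j * x' i j < \sum_j v i j * x i j).

Definition fPO (R : realType) (n m k : nat) (v : 'M[R]_(n, m))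
    (A : 'I_n -> {set 'I_m}) : Prop :=
  ~ exists x : 'M[R]_(n, m),
      balanced_fractional k x /\ pareto_dominates v x (alloc_mx R A).

Definition weighted_welfare (R : realType) (n m : nat) (v : 'M[R]_(n, m))
    (alpha : 'I_n -> R) (A : 'I_n -> {set 'I_m}) : R :=
  \sum_i alpha i * value v i (A i).

(* Main.v *)
(* If A is fPO, no nonnegative combination of the utility changes u(B) - u(A),
   B a balanced allocation, is nonnegative and positive for agent i: rescaled,
   it would come from a convex combination of allocations dominating A.
   Farkas' lemma yields weights alpha >= 0 with alpha_i > 0 that make all these
   changes nonpositive; summing over i gives strictly positive weights.
   Conversely, let A maximize the weighted welfare.  Permuting the items cannot
   improve it, so the digraph on items whose arc j -> j' weighs the gain of
   giving j to the owner of j' has no positive cycle, hence carries a potential.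
   Its values are an optimal dual solution of the fractional assignment problem,
   so A also maximizes the weighted welfare among fractional allocations, and
   cannot be dominated. *)
Require Import Defs.
From mathcomp Require Import all_boot all_order all_algebra.
From mathcomp Require Import fingroup perm.
From mathcomp Require Import classical_sets reals.
From mathcomp Require Import zify ring lra.

Import Order.TTheory GRing.Theory Num.Theory.
Local Open Scope ring_scope.

(** * Farkas' lemma for a finitely generated cone *)

(** Induction on the generators. If a separator [x] for the tail [s] fails on [t0], subtracting
    multiples of [a t0] makes every functional vanish at [x], and the induction hypothesis applies
    to these reduced functionals. *)
Lemma farkas (R : realFieldType) (T : eqType) (I : finType) (s : seq T)
    (a : T -> I -> R) (g : I -> R) :
  uniq s ->
  (exists2 l : T -> R, forall t, 0 <= l t &
     forall i, g i = \sum_(t <- s) l t * a t i) \/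
  (exists2 y : I -> R, {in s, forall t, \sum_i a t i * y i <= 0} &
     0 < \sum_i g i * y i).
Proof.
elim: s a g => [|t0 s IHs] a g /=.
  move=> _; case: (boolP [forall i, g i == 0]) => [/forallP g0|].
    by left; exists (fun=> 0) => // i; rewrite big_nil (eqP (g0 i)).
  rewrite negb_forall => /existsP[i gi]; right; exists g => //.
  rewrite (bigD1 i) //= ltr_pwDl ?sumr_ge0 //; last first.
    by move=> j _; rewrite -expr2 sqr_ge0.
  by rewrite -expr2 exprn_even_gt0.
case/andP=> t0s us.
have sN t : t \in s -> (t == t0) = false.
  by apply: contraTF => /eqP ->.
have [[l l_ge0 gE]|[x ax gx]] := IHs a g us.
  left; exists (fun t => if t == t0 then 0 else l t) => [t|i].
    by case: ifP.
  rewrite big_cons eqxx mul0r add0r gE; apply: eq_big_seq => t ts.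
  by rewrite sN.
pose d h (y : I -> R) : R := \sum_i h i * y i.
have dD h h' c y : d (fun i => h i - c * h' i) y = d h y - c * d h' y.
  rewrite /d mulr_sumr -sumrB; apply: eq_bigr => i _; ring.
have dD' h y y' c : d h (fun i => y i - c * y' i) = d h y - c * d h y'.
  rewrite /d mulr_sumr -sumrB; apply: eq_bigr => i _; ring.
have [a0x|a0x] := leP (d (a t0) x) 0.
  right; exists x => // t; rewrite inE => /predU1P[->//|]; exact: ax.
(* Project along [x] onto the kernel of [a t0]. *)
pose r h := d h x / d (a t0) x.
have [[l l_ge0 gE]|[y ay gy]] :=
    IHs (fun t i => a t i - r (a t) * a t0 i) (fun i => g i - r g * a t0 i) us.
  (* The coefficient of [t0] is nonnegative: [x] separates [g] from [s], so [r g > 0] while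
     [r (a t) <= 0] for [t] in [s]. *)
  left; exists (fun t => if t == t0 then
      r g - \sum_(t' <- s) l t' * r (a t') else l t) => [t|i].
    case: ifP => // _; rewrite subr_ge0 (@le_trans _ _ 0) //; last first.
      by rewrite divr_ge0 // ltW.
    rewrite big_seq sumr_le0 // => t' t's; rewrite mulr_ge0_le0 //.
    by rewrite mulr_le0_ge0 ?invr_ge0 ?(ltW a0x) // ax.
  rewrite big_cons eqxx mulrBl.
  rewrite [X in _ = _ + X](eq_big_seq (fun t => l t * a t i)); last first.
    by move=> t ts; rewrite /= sN.
  move: (gE i); rewrite (eq_bigr (fun t => l t * a t i -
      l t * r (a t) * a t0 i)); last by move=> t _; ring.
  by rewrite sumrB -mulr_suml => gEi; lra.
have a0x' : d (a t0) x != 0 by rewrite gt_eqF.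
have dy h : d h (fun i => y i - d (a t0) y / d (a t0) x * x i) =
    d (fun i => h i - r h * a t0 i) y.
  by rewrite dD dD' /r; field.
right; exists (fun i => y i - d (a t0) y / d (a t0) x * x i); last first.
  by rewrite -/(d g _) dy.
move=> t; rewrite inE -/(d (a t) _) dy => /predU1P[->|]; last exact: ay.
by rewrite dD /r divff // mul1r subrr.
Qed.

(** * Weighted digraphs: closed walks and potentials *)

Fixpoint walk_weight (R : zmodType) (T : Type) (w : T -> T -> R) (x : T)
    (p : seq T) : R :=
  if p is y :: p' then w x y + walk_weight R T w y p' else 0.
Arguments walk_weight {R T}.

Lemma walk_weight_cat (R : zmodType) (T : Type) (w : T -> T -> R) x p p' :
  walk_weight w x (p ++ p') =
  walk_weight w x p + walk_weight w (last x p) p'.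
Proof. by elim: p x => [|y p IHp] x /=; rewrite ?add0r // IHp addrA. Qed.

Lemma walk_weight_fpath (R : zmodType) (T : eqType) (w : T -> T -> R)
    (f : T -> T) x p z :
  fpath f x (rcons p z) ->
  walk_weight w x (rcons p z) = \sum_(y <- x :: p) w y (f y).
Proof.
elim: p x => [|y p IHp] x /= /andP[/eqP fx fp].
  by rewrite big_seq1 addr0 fx.
by rewrite big_cons fx IHp.
Qed.

(** Strong induction on length: a closed walk that repeats a vertex splits into two shorter closed
    walks, and a simple cycle is a permutation fixing all other vertices. *)
Lemma closed_walk_le0 (R : numDomainType) (T : finType) (w : T -> T -> R) :
  (forall x, w x x = 0) ->
  (forall s : {perm T}, \sum_x w x (s x) <= 0) ->
  forall x p, walk_weight w x (rcons p x) <= 0.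
Proof.
move=> w0 ws x p; have [l] := ubnP (size p).
elim: l x p => // l IHl x p; rewrite ltnS => pl.
have [xp|xp] := boolP (x \in p).
  case/splitPr: xp pl => p1 p2; rewrite size_cat /= addnS => pl.
  rewrite rcons_cat rcons_cons -cat_rcons walk_weight_cat last_rcons.
  rewrite -[leRHS]addr0 lerD // IHl // (leq_trans _ pl) // ltnS.
    exact: leq_addr.
  exact: leq_addl.
have [up|] := boolP (uniq p).
  have uxp : uniq (x :: p) by rewrite /= xp.
  (* [next] is the identity off the cycle, so it is a permutation of [T] whose fixed points weigh
     0. *)
  rewrite (walk_weight_fpath _ _ _ (next (x :: p))); last first.
    exact: (cycle_next uxp).
  rewrite big_uniq //=; apply: le_trans (ws (perm (can_inj (prev_next uxp)))).
  rewrite [leRHS](bigID (fun y => y \in x :: p)) /= [X in _ + X]big1 => [|y yp].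
    rewrite addr0 le_eqVlt; apply/orP; left; apply/eqP/eq_bigr => y _.
    by rewrite permE.
  by rewrite permE next_nth (negPf yp) w0.
move=> /(uniqPn x)[i [j [ij jp ijE]]].
have [y [p1 [p2 [p3 pE]]]] : exists y p1 p2 p3, p = p1 ++ y :: p2 ++ y :: p3.
  exists (nth x p i), (take i p), (take (j - i.+1) (drop i.+1 p)), (drop j.+1 p).
  rewrite {2}ijE -[in LHS](cat_take_drop i p) (drop_nth x) ?(ltn_trans ij) //.
  congr (_ ++ _ :: _); rewrite -[LHS](cat_take_drop (j - i.+1)) drop_drop.
  by rewrite subnK // (drop_nth x jp).
(* Cut out the closed walk [rcons p2 y] at [y]; the rest is still a closed walk at [x]. *)
have -> : rcons p x = (rcons p1 y ++ rcons p2 y) ++ rcons p3 x.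
  by rewrite -catA !cat_rcons pE !(rcons_cat, rcons_cons).
rewrite !walk_weight_cat last_cat !last_rcons addrAC -{2}(last_rcons x p1 y).
rewrite -walk_weight_cat -rcons_cat -[leRHS]addr0.
rewrite lerD // IHl // (leq_trans _ pl) // pE ?size_cat /= ?size_cat ?size_rcons /=; lia.
Qed.

(** [q x] is the supremum of the weights of walks from [r] to [x]. It is finite because the arc from
    [x] back to [r] closes such a walk, and appending an arc gives the inequality. *)
Lemma potential (R : realType) (T : Type) (w : T -> T -> R) (r : T) :
  (forall x p, walk_weight w x (rcons p x) <= 0) ->
  exists q : T -> R, forall x y, q x + w x y <= q y.
Proof.
move=> wc; pose W x : set R :=
  fun c => exists2 p, last r p = x & walk_weight w r p = c.
have Wub x : ubound (W x) (- w x r).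
  move=> _ [p px <-]; move: (wc r p).
  by rewrite -cats1 walk_weight_cat px /= addr0; lra.
have W0 x : W x (w r x) by exists [:: x] => //=; rewrite addr0.
exists (fun x => sup (W x)) => x y.
rewrite -lerBrDr; apply: ge_sup => [|_ [p px <-]]; first by exists (w r x).
rewrite lerBrDr; apply: ub_le_sup; first by exists (- w y r); exact: Wub.
by exists (rcons p y); rewrite ?last_rcons // -cats1 walk_weight_cat px /= addr0.
Qed.

(** * Allocations as owner maps from items to agents *)

Lemma owner (n m : nat) (A : 'I_n -> {set 'I_m}) :
  allocation A ->
  exists f : {ffun 'I_m -> 'I_n}, forall i, A i = [set j | f j == i].
Proof.
case=> Acov Adisj.
have own j : exists i, j \in A i.
  have : j \in \bigcup_i A i by rewrite Acov inE.
  by case/bigcupP=> i _ ji; exists i.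
have [f fA] := fin_all_exists own.
exists (finfun f) => i; apply/setP => j; rewrite inE ffunE.
apply/idP/eqP => [ji|<- //]; apply/eqP/negP => /negP fji.
by move: (disjointFr (Adisj _ _ fji) (fA j)); rewrite ji.
Qed.

Lemma owner_allocation (n m k : nat) (f : 'I_m -> 'I_n) :
  (forall i, #|[set j | f j == i]| = k) ->
  balanced_allocation k (fun i => [set j | f j == i]).
Proof.
move=> fk; split=> //; split.
  by apply/setP => j; rewrite inE; apply/bigcupP; exists (f j); rewrite ?inE.
move=> i i' ii'; rewrite disjoint_subset; apply/fintype.subsetP => j.
by rewrite !inE => /eqP ->.
Qed.

Lemma sum_owner (R : nmodType) (n m : nat) (f : 'I_m -> 'I_n)
    (F : 'I_n -> 'I_m -> R) :
  \sum_i \sum_(j in [set j | f j == i]) F i j = \sum_j F (f j) j.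
Proof.
rewrite (partition_big f xpredT) //=; apply: eq_bigr => i _.
by apply: eq_big => [j|j]; rewrite inE // => /eqP ->.
Qed.

(** Weak duality: with [q] a potential and [h i] an item of agent [i], the item prices
    [c (f j) j - q j] and agent prices [q (h i)] satisfy the dual constraints, since their sum
    bounds [c i j]. *)
Lemma fractional_le_owner (R : realType) (n m k : nat) (c : 'I_n -> 'I_m -> R)
    (f : 'I_m -> 'I_n) (x : 'M[R]_(n, m)) :
  (0 < m)%N -> (0 < k)%N ->
  (forall i, #|[set j | f j == i]| = k) ->
  (forall s : {perm 'I_m}, \sum_j c (f (s j)) j <= \sum_j c (f j) j) ->
  balanced_fractional k x ->
  \sum_i \sum_j c i j * x i j <= \sum_j c (f j) j.
Proof.
move=> m_gt0 k_gt0 fk opt [x_ge0 xrow xcol].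
pose w j j' : R := c (f j') j - c (f j) j.
have [|q qP] := @potential R _ w (Ordinal m_gt0).
  apply: closed_walk_le0 => [j|s]; first by rewrite /w subrr.
  by rewrite sumrB subr_le0.
have ex i : exists j, f j = i.
  have : (0 < #|[set j | f j == i]|)%N by rewrite fk.
  by case/card_gt0P=> j; rewrite inE => /eqP; exists j.
have [h hP] := fin_all_exists ex.
apply: (@le_trans _ _
    (\sum_i \sum_j (c (f j) j - q j + q (h i)) * x i j)).
  apply: ler_sum => i _; apply: ler_sum => j _; apply: ler_wpM2r => //.
  by have := qP j (h i); rewrite /w hP; lra.
under eq_bigr => i _ do under eq_bigr => j _ do rewrite mulrDl.
under eq_bigr => i _ do rewrite big_split /= -mulr_sumr xrow.
rewrite big_split /= exchange_big /=.
under eq_bigr => j _ do rewrite -mulr_sumr xcol mulr1.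
rewrite sumrB -addrA gerDl addrC subr_le0.
(* Charge [q (h i)] once to each of the [k] items of [i]; arcs between items of one owner weigh 0,
   so [q (h (f j)) <= q j]. *)
apply: (@le_trans _ _ (\sum_j q (h (f j)))).
  rewrite -(sum_owner _ _ _ f (fun i _ => q (h i))) le_eqVlt; apply/orP; left.
  by apply/eqP/eq_bigr => i _; rewrite sumr_const fk mulr_natr.
apply: ler_sum => j _; have := qP (h (f j)) j.
by rewrite /w hP subrr addr0.
Qed.

Lemma weighted_welfare_owner (R : realType) (n m : nat) (v : 'M[R]_(n, m))
    (alpha : 'I_n -> R) (f : 'I_m -> 'I_n) (A : 'I_n -> {set 'I_m}) :
  (forall i, A i = [set j | f j == i]) ->
  weighted_welfare v alpha A = \sum_j alpha (f j) * v (f j) j.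
Proof.
move=> AE; rewrite -(sum_owner _ _ _ f (fun i j => alpha i * v i j)).
by apply: eq_bigr => i _; rewrite /value AE mulr_sumr.
Qed.

Lemma alloc_mx_value (R : realType) (n m : nat) (v : 'M[R]_(n, m))
    (A : 'I_n -> {set 'I_m}) i :
  \sum_j v i j * alloc_mx R A i j = value v i (A i).
Proof.
rewrite /value [RHS]big_mkcond; apply: eq_bigr => j _.
by rewrite mxE; case: ifP; rewrite ?mulr1 ?mulr0.
Qed.

Lemma alloc_mx_balanced (R : realType) (n m k : nat)
    (A : 'I_n -> {set 'I_m}) :
  balanced_allocation k A -> balanced_fractional k (alloc_mx R A).
Proof.
move=> [Aalloc Ak]; have [f fA] := owner _ _ _ Aalloc; split=> [i j|i|j].
- by rewrite mxE ler0n.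
- rewrite -(Ak i) -sum1_card natr_sum [RHS]big_mkcond; apply: eq_bigr => j _.
  by rewrite mxE; case: ifP.
- rewrite (bigD1 (f j)) //= big1 => [|i /negPf ij].
    by rewrite mxE fA inE eqxx addr0.
  by rewrite mxE fA inE eq_sym ij.
Qed.

(** Normalizes the unscaled Farkas coefficients; the weight 1 on [x0] keeps the total positive even
    when [l] vanishes. *)
Lemma balanced_fractional_conv (R : realType) (n m k : nat) (T : finType)
    (x0 : 'M[R]_(n, m)) (l : T -> R) (x : T -> 'M[R]_(n, m)) :
  (forall t, 0 <= l t) -> balanced_fractional k x0 ->
  (forall t, balanced_fractional k (x t)) ->
  balanced_fractional k
    ((1 + \sum_t l t)^-1 *: (x0 + \sum_t l t *: x t)).
Proof.
move=> l_ge0 [x0_ge0 x0row x0col] xb.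
have L_gt0 : 0 < 1 + \sum_t l t by rewrite ltr_pwDl ?sumr_ge0.
have L0 : 1 + \sum_t l t != 0 by rewrite gt_eqF.
have xE i j : ((1 + \sum_t l t)^-1 *: (x0 + \sum_t l t *: x t)) i j =
    (1 + \sum_t l t)^-1 * (x0 i j + \sum_t l t * x t i j).
  rewrite !mxE summxE; congr (_ * (_ + _)).
  by apply: eq_bigr => t _; rewrite mxE.
split=> [i j|i|j].
- rewrite xE mulr_ge0 ?invr_ge0 ?(ltW L_gt0) // addr_ge0 // sumr_ge0 // => t _.
  by rewrite mulr_ge0 //; case: (xb t).
- under eq_bigr do rewrite xE.
  rewrite -mulr_sumr big_split /= x0row exchange_big /=.
  rewrite [X in _ * (_ + X)](eq_bigr (fun t => l t * k%:R)) => [|t _]; last first.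
    by rewrite -mulr_sumr; have [_ -> _] := xb t.
  by rewrite -mulr_suml -[X in X + _ * _]mul1r -mulrDl mulKf.
- under eq_bigr do rewrite xE.
  rewrite -mulr_sumr big_split /= x0col exchange_big /=.
  rewrite [X in _ * (_ + X)](eq_bigr l) => [|t _]; last first.
    by rewrite -mulr_sumr; have [_ _ ->] := xb t; rewrite mulr1.
  by rewrite mulVf.
Qed.

(** * From fractional Pareto optimality to positive weights *)

Lemma fPO_weights (R : realType) (n m k : nat) (v : 'M[R]_(n, m))
    (A : 'I_n -> {set 'I_m}) :
  balanced_allocation k A -> fPO k v A ->
  exists alpha : 'I_n -> R,
    (forall i, 0 < alpha i) /\
    (forall B : 'I_n -> {set 'I_m}, balanced_allocation k B ->
       weighted_welfare v alpha B <= weighted_welfare v alpha A).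
Proof.
move=> hA hfPO.
pose bal (f : {ffun 'I_m -> 'I_n}) := [forall i, #|[set j | f j == i]| == k].
(* Owner maps make the balanced allocations a finite type, hence a finite family of generators. *)
pose T := {f : {ffun 'I_m -> 'I_n} | bal f}.
pose al (t : T) i : {set 'I_m} := [set j | val t j == i].
have alb t : balanced_allocation k (al t).
  by apply: owner_allocation => i; apply/eqP; move/forallP: (valP t).
pose gain t i := value v i (al t i) - value v i (A i).
suff main i : exists y : 'I_n -> R, [/\ forall l, 0 <= y l, 0 < y i &
    forall t, \sum_l gain t l * y l <= 0].
  have [y yP] := fin_all_exists main.
  exists (fun l => \sum_i y i l); split=> [i|B hB].
    rewrite (bigD1 i) //= ltr_pwDl //; first by have [] := yP i.
    by apply: sumr_ge0 => i' _; have [] := yP i'.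
  have [f fB] := owner _ _ _ hB.1.
  have fbal : bal f by apply/forallP => i; rewrite -fB hB.2.
  rewrite -subr_le0 /weighted_welfare -sumrB.
  under eq_bigr => l _ do rewrite -mulrBr mulr_suml.
  rewrite exchange_big sumr_le0 //= => i _.
  have [_ _ /(_ (exist _ f fbal))] := yP i; apply: le_trans.
  rewrite le_eqVlt; apply/orP; left; apply/eqP/eq_bigr => l _.
  by rewrite mulrC /gain fB.
(* The negated unit vectors among the generators force [y >= 0], and the target, the unit vector of
   [i], forces [0 < y i]. *)
pose a (t : T + 'I_n) (l : 'I_n) : R :=
  match t with inl t => gain t l | inr i' => - (l == i')%:R end.
have de (i' : 'I_n) (y : 'I_n -> R) : \sum_l (l == i')%:R * y l = y i'.
  rewrite (bigD1 i') //= eqxx mul1r big1 ?addr0 // => l /negPf ->.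
  by rewrite mul0r.
have [[l l_ge0 lE]|[y ya yi]] := farkas R _ _ (index_enum (T + 'I_n)%type)
    a (fun l => (l == i)%:R) (index_enum_uniq _); last first.
  exists y; split; last first.
  - by move=> t; apply: (ya (inl t)); rewrite mem_index_enum.
  - by rewrite -(de i).
  move=> i'; have := ya (inr i') (mem_index_enum _).
  rewrite /a; under eq_bigr do rewrite mulNr.
  by rewrite sumrN de oppr_le0.
exfalso; apply: hfPO; pose L := 1 + \sum_(t : T) l (inl t).
have L_gt0 : 0 < L by rewrite ltr_pwDl ?sumr_ge0.
pose x := L^-1 *: (alloc_mx R A + \sum_(t : T) l (inl t) *: alloc_mx R (al t)).
(* By [lE] the combined gains equal the unit vector of [i] plus the nonnegative slacks [l (inr i')],
   so [x] dominates [A], strictly at [i]. *)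
have xgain i' : \sum_j v i' j * x i' j - value v i' (A i') =
    L^-1 * ((i' == i)%:R + l (inr i')).
  have -> : (i' == i)%:R + l (inr i') = \sum_(t : T) l (inl t) * gain t i'.
    rewrite lE big_sumType /=.
    under [X in _ + X + _]eq_bigr => i2 _ do rewrite mulrN mulrC eq_sym.
    by rewrite sumrN de subrK.
  have -> : \sum_j v i' j * x i' j =
      L^-1 * (value v i' (A i') + \sum_(t : T) l (inl t) * value v i' (al t i')).
    rewrite -alloc_mx_value; under [X in _ + X]eq_bigr do
      rewrite -alloc_mx_value mulr_sumr.
    rewrite exchange_big -big_split mulr_sumr /=; apply: eq_bigr => j _.
    rewrite 2!mxE [X in _ * (_ * (_ + X))]summxE mulrCA mulrDr mulr_sumr.
    by congr (_ * (_ + _)); apply: eq_bigr => t _; rewrite mxE mulrCA.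
  rewrite /gain; under [in RHS]eq_bigr do rewrite mulrBr.
  have L0 : L != 0 by rewrite gt_eqF.
  rewrite sumrB -mulr_suml; apply: (mulfI L0); rewrite mulrBr !mulVKf //.
  by rewrite /L; ring.
exists x; split.
  by apply: balanced_fractional_conv => // [|t]; exact: alloc_mx_balanced.
split=> [i'|]; last exists i; rewrite alloc_mx_value.
  by rewrite -subr_ge0 xgain mulr_ge0 ?invr_ge0 ?(ltW L_gt0) ?addr_ge0.
by rewrite -subr_gt0 xgain eqxx mulr_gt0 ?invr_gt0 // ltr_pwDl.
Qed.

(** * The equivalence, with weights excluding domination *)

Theorem proposition1 (R : realType) (n m k : nat)
    (hn : (0 < n)%N) (hm : (0 < m)%N) (hk : (0 < k)%N) (hmkn : m = (k * n)%N)
    (v : 'M[R]_(n, m)) (hv : forall i j, 0 <= v i j)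
    (A : 'I_n -> {set 'I_m}) (hA : balanced_allocation k A) :
  fPO k v A <->
  exists alpha : 'I_n -> R,
    (forall i, 0 < alpha i) /\
    (forall B : 'I_n -> {set 'I_m}, balanced_allocation k B ->
       weighted_welfare v alpha B <= weighted_welfare v alpha A).
Proof.
split=> [|[alpha [alpha_gt0 opt]]]; first exact: fPO_weights.
case=> x [xb [xge [i0 xgt]]].
have [f fA] := owner _ _ _ hA.1.
have fk i : #|[set j | f j == i]| = k by rewrite -fA hA.2.
have : \sum_i \sum_j alpha i * v i j * x i j <=
    \sum_j alpha (f j) * v (f j) j.
  apply: (fractional_le_owner _ _ _ _ (fun i j => alpha i * v i j)) xb => // s.
  rewrite -(weighted_welfare_owner _ _ _ v alpha f A) //.
  (* The owner map [f \o s] is again balanced, its bundles being preimages under [s] of those of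
     [A], so [opt] applies to it. *)
  rewrite -(weighted_welfare_owner _ _ _ v alpha (f \o s)
    (fun i => [set j | f (s j) == i])) //.
  apply/opt/owner_allocation => i.
  rewrite -[RHS](fk i) -[RHS](card_preimset _ (@perm_inj _ s)).
  by apply: eq_card => j; rewrite !inE.
(* Positive weights turn domination into a strictly larger weighted sum, against the bound just
   obtained. *)
apply/negP; rewrite -ltNge -(weighted_welfare_owner _ _ _ v alpha f A) //.
rewrite /weighted_welfare (bigD1 i0) //= [ltRHS](bigD1 i0) //=.
have vxE i : \sum_j alpha i * v i j * x i j = alpha i * \sum_j v i j * x i j.
  by rewrite mulr_sumr; apply: eq_bigr => j _; rewrite mulrA.
apply: ltr_leD; first by rewrite vxE -alloc_mx_value ltr_pM2l.
by apply: ler_sum => i _; rewrite vxE -alloc_mx_value ler_pM2l.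
Qed.
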